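(* Let $r\ge 2$ be a constant, $n\ge 2$, and $k\ge 2r$ a divisor of $n$. Let $g^k:\{0,1\}^k\to\mathbb{R}$ be $\mathrm{Fork}_{k,r}$ with the last $r$ bits of the argument complemented, i.e. $g^k(z_0\dots z_{k-1})=\mathrm{Fork}_{k,r}(z_0\dots z_{k-r-1}\bar z_{k-r}\dots\bar z_{k-1})$, so that $1^k$ is its unique optimum, where $\mathrm{Fork}_{k,r}(x)=k+1$ if $x=0^r1^{k-r}$, $k+2$ if $x=1^{k-r}0^r$, and $|x|_1$ otherwise. Define LeadingOnes with $k$-block Fork as $$F(x)=\sum_{i=0}^{n/k-1} g^k(x_{ik}\dots x_{ik+k-1})\cdot\prod_{j=0}^{ik-1}x_j,\quad x\in\{0,1\}^n.$$ Then the expected optimization time $E(T)$ of the (1+1) EA (mutation probability $1/n$) on $F$ satisfies $E(T)\in\Theta\!\left(\frac1k n^{2r+1}\right)$.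
   Context: The (1+1) EA with mutation probability $1/n$: start with $x$ uniform in $\{0,1\}^n$; each iteration create $y$ by flipping each bit of $x$ independently with probability $1/n$, set $x\gets y$ if $F(y)\ge F(x)$. Optimization time = number of iterations until the optimum is the current solution. Asymptotics are with respect to $n$. *)

(* Defs.v *)
From HB Require Import structures.
From mathcomp Require Import all_boot all_order all_algebra.
From mathcomp Require Import all_classical all_reals.
From mathcomp Require Import ereal sequences.
Set Implicit Arguments. Unset Strict Implicit. Unset Printing Implicit Defensive.
Import Order.TTheory GRing.Theory Num.Theory.

Definition fork (k r : nat) (x : seq bool) : nat :=
  if x == nseq r false ++ nseq (k - r) true then k.+1
  else if x == nseq (k - r) true ++ nseq r false then k.+2
  else count id x.

Definition gk (k r : nat) (z : seq bool) : nat :=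
  fork k r (take (k - r) z ++ map negb (drop (k - r) z)).

Definition block (k : nat) (x : seq bool) (i : nat) : seq bool :=
  take k (drop (i * k) x).

Definition LOFork (n k r : nat) (x : n.-tuple bool) : nat :=
  \sum_(i < n %/ k) gk k r (block k x i) * \prod_(j < i * k) nth false x j.

Definition hamming (n : nat) (x y : n.-tuple bool) : nat :=
  \sum_(j < n) (nth false x j != nth false y j).

Local Open Scope ring_scope.

Definition mutprob (R : realType) (n : nat) (x y : n.-tuple bool) : R :=
  (n%:R^-1) ^+ (hamming x y) * (1 - n%:R^-1) ^+ (n - hamming x y).

Definition ea_kernel (R : realType) (n : nat) (f : n.-tuple bool -> nat)
    (x z : n.-tuple bool) : R :=
  (if (f x <= f z)%N then mutprob R x z else 0)
  + (if z == x then \sum_(y : n.-tuple bool | (f y < f x)%N) mutprob R x y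
     else 0).

Definition ones (n : nat) : n.-tuple bool := [tuple of nseq n true].

(* q t x = Pr[X_t = x and X_s <> optimum for all s <= t],
   starting from the uniform distribution on {0,1}^n. *)
Fixpoint killed (R : realType) (n : nat) (f : n.-tuple bool -> nat)
    (opt : n.-tuple bool) (t : nat) (z : n.-tuple bool) : R :=
  if z == opt then 0 else
  match t with
  | 0 => (2 ^ n)%:R^-1
  | t'.+1 => \sum_(x : n.-tuple bool) killed R f opt t' x * ea_kernel R f x z
  end.

Definition tail_prob (R : realType) (n : nat) (f : n.-tuple bool -> nat)
    (opt : n.-tuple bool) (t : nat) : R :=
  \sum_(x : n.-tuple bool) killed R f opt t x.

(* E(T) = sum_{t >= 0} Pr[T > t], in the extended reals *)
Definition expected_opt_time (R : realType) (n : nat)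
    (f : n.-tuple bool -> nat) (opt : n.-tuple bool) : \bar R :=
  (\sum_(0 <= t <oo) (tail_prob R f opt t)%:E)%E.

(* Main.v *)
Require Import Defs.
From HB Require Import structures.
From mathcomp Require Import all_boot all_order all_algebra.
From mathcomp Require Import all_classical all_reals.
From mathcomp Require Import ereal sequences normedtype filter.
From mathcomp Require Import zify lra.
Import Order.TTheory GRing.Theory Num.Theory.

(** Upper bound: fitness levels.  If the first incomplete block has value v, a
    jump of 1, r or 2r prescribed bits improves it, according to whether v < k,
    v = k or v = k + 1; such a jump has probability at least n^-1, n^-r or
    n^-2r up to a factor 8.

    Lower bound: reversing block m in the coordinates of [fork] is an isometry
    of the hypercube which preserves every fitness value below that of the
    local optimum of block m, and exchanges the search points where block m sits
    at its local optimum with those where blocks 0, ..., m are all complete.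
    Hence the local optimum of each of the n/k blocks is visited with
    probability exactly 1/2; leaving it requires 2r prescribed bits to flip,
    so it costs n^2r expected steps. *)

(** * Hamming distance and the block function *)

Section SeqHamming.
Implicit Types s t : seq bool.

Definition seq_hamming s t := count (fun p => p.1 != p.2) (zip s t).

Lemma hamming_seq n (x y : n.-tuple bool) : hamming x y = seq_hamming x y.
Proof.
rewrite /hamming /seq_hamming -sum1_count (big_nth (false, false)).
rewrite size_zip !size_tuple minnn big_mkord [RHS]big_mkcond; apply: eq_bigr => j _.
by rewrite nth_zip ?size_tuple //=; case: eqP.
Qed.

Lemma seq_hamming_cat s1 t1 s2 t2 : size s1 = size t1 ->
  seq_hamming (s1 ++ s2) (t1 ++ t2) = seq_hamming s1 t1 + seq_hamming s2 t2.
Proof. by move=> e; rewrite /seq_hamming zip_cat // count_cat. Qed.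

Lemma seq_hamming_rev s t : size s = size t ->
  seq_hamming (rev s) (rev t) = seq_hamming s t.
Proof. by move=> e; rewrite /seq_hamming -rev_zip // count_rev. Qed.

Lemma seq_hamming_negb s t :
  seq_hamming (map negb s) (map negb t) = seq_hamming s t.
Proof.
elim: s t => [|x s IH] [|y t] //=; rewrite /seq_hamming /= -!/(seq_hamming _ _) IH.
by case: x; case: y.
Qed.

Lemma seq_hamming_id s : seq_hamming s s = 0.
Proof. by elim: s => //= x s; rewrite /seq_hamming /= eqxx. Qed.

Lemma seq_hamming_nseq m (x y : bool) :
  seq_hamming (nseq m x) (nseq m y) = (x != y) * m.
Proof.
elim: m => [|m IH]; first by rewrite muln0.
by rewrite /seq_hamming /= -/(seq_hamming _ _) IH mulnS.
Qed.

End SeqHamming.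

Section Block.
Variables k r : nat.
Hypothesis r_gt0 : 0 < r.
Hypothesis rk : 2 * r <= k.
Implicit Types z b : seq bool.

Definition compl_tail z := take (k - r) z ++ map negb (drop (k - r) z).

Lemma gkE z : gk k r z = fork k r (compl_tail z). Proof. by []. Qed.

Lemma size_compl_tail z : size (compl_tail z) = size z.
Proof. by rewrite size_cat size_map -size_cat cat_take_drop. Qed.

Lemma compl_tail_cat u v : size u = k - r -> compl_tail (u ++ v) = u ++ map negb v.
Proof. by move=> e; rewrite /compl_tail take_size_cat // drop_size_cat. Qed.

Lemma compl_tailK z : size z = k -> compl_tail (compl_tail z) = z.
Proof.
move=> e; rewrite {2}/compl_tail compl_tail_cat; last by rewrite size_takel // e; lia.
by rewrite (mapK negbK) cat_take_drop.
Qed.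

Lemma seq_hamming_compl_tail z b : size z = k -> size b = k ->
  seq_hamming (compl_tail z) (compl_tail b) = seq_hamming z b.
Proof.
move=> ez eb; rewrite seq_hamming_cat ?size_take ?ez ?eb // seq_hamming_negb.
by rewrite -seq_hamming_cat ?size_take ?ez ?eb // !cat_take_drop.
Qed.

Definition full_block := nseq k true.
Definition trap_block := nseq r false ++ nseq (k - 2 * r) true ++ nseq r false.

Lemma size_trap_block : size trap_block = k.
Proof. by rewrite !size_cat !size_nseq; lia. Qed.

Lemma compl_tail_full : compl_tail full_block = nseq (k - r) true ++ nseq r false.
Proof.
rewrite /full_block -[in LHS](@subnK r k); last lia.
by rewrite nseqD compl_tail_cat ?size_nseq // map_nseq.
Qed.

Lemma compl_tail_trap : compl_tail trap_block = nseq r false ++ nseq (k - r) true.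
Proof.
rewrite /trap_block catA compl_tail_cat; last by rewrite size_cat !size_nseq; lia.
by rewrite map_nseq -catA -nseqD; congr (_ ++ nseq _ _); lia.
Qed.

Lemma compl_tail_eq z b : size z = k -> size b = k ->
  (compl_tail z == compl_tail b) = (z == b).
Proof.
move=> ez eb; apply/eqP/eqP => [e|-> //].
by rewrite -(compl_tailK _ ez) e compl_tailK.
Qed.

Lemma gk_cases z : size z = k ->
  gk k r z = if z == trap_block then k.+1
             else if z == full_block then k.+2 else count id (compl_tail z).
Proof.
move=> ez; rewrite gkE /fork -compl_tail_trap -compl_tail_full.
by rewrite !compl_tail_eq ?size_nseq ?size_trap_block.
Qed.

Lemma trap_neq_full : trap_block != full_block.
Proof.
apply/eqP => e; have := congr1 (fun s => nth true s 0) e.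
by rewrite /trap_block /full_block nth_cat size_nseq r_gt0 !nth_nseq r_gt0; case: ifP.
Qed.

Lemma gk_full : gk k r full_block = k.+2.
Proof.
by rewrite gk_cases ?size_nseq // eqxx eq_sym (negbTE trap_neq_full).
Qed.

Lemma gk_trap : gk k r trap_block = k.+1.
Proof. by rewrite gk_cases ?size_trap_block // eqxx. Qed.

Lemma gk_generic z : size z = k -> z != trap_block -> z != full_block -> gk k r z <= k.
Proof.
move=> ez /negbTE h1 /negbTE h2; rewrite gk_cases // h1 h2.
by apply: leq_trans (count_size _ _) _; rewrite size_compl_tail ez.
Qed.

Lemma gk_not_full z : size z = k -> z != full_block -> gk k r z <= k.+1.
Proof.
move=> ez nf; case: (eqVneq z trap_block) => [->|nt]; first by rewrite gk_trap.
exact: leqW (gk_generic z ez nt nf).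
Qed.

Lemma gk_ge_count z : size z = k -> count id (compl_tail z) <= gk k r z.
Proof.
move=> ez; have : count id (compl_tail z) <= k.
  by apply: leq_trans (count_size _ _) _; rewrite size_compl_tail ez.
by rewrite gk_cases //; case: (z == trap_block); case: (z == full_block) => //; lia.
Qed.

(* Reversal in the coordinates of [fork]: it exchanges the two special points
   and keeps the number of ones. *)
Definition mirror z := compl_tail (rev (compl_tail z)).

Lemma size_mirror z : size (mirror z) = size z.
Proof. by rewrite size_compl_tail size_rev size_compl_tail. Qed.

Lemma mirrorK z : size z = k -> mirror (mirror z) = z.
Proof.
move=> ez; rewrite /mirror compl_tailK ?revK ?compl_tailK //.
by rewrite size_rev size_compl_tail.
Qed.

Lemma mirror_trap : mirror trap_block = full_block.
Proof.
rewrite /mirror compl_tail_trap rev_cat !rev_nseq -compl_tail_full.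
by rewrite compl_tailK // size_nseq.
Qed.

Lemma mirror_full : mirror full_block = trap_block.
Proof. by rewrite -mirror_trap mirrorK // size_trap_block. Qed.

Lemma gk_mirror z : size z = k -> z != trap_block -> z != full_block ->
  gk k r (mirror z) = gk k r z.
Proof.
move=> ez nt nf; have em : size (mirror z) = k by rewrite size_mirror.
rewrite !gk_cases // (negbTE nt) (negbTE nf) !ifN.
- by rewrite /mirror compl_tailK ?count_rev // size_rev size_compl_tail.
- by apply: contra nt => /eqP e; rewrite -(mirrorK _ ez) e mirror_full.
- by apply: contra nf => /eqP e; rewrite -(mirrorK _ ez) e mirror_trap.
Qed.

Lemma seq_hamming_mirror z b : size z = k -> size b = k ->
  seq_hamming (mirror z) (mirror b) = seq_hamming z b.
Proof.
move=> ez eb; rewrite /mirror seq_hamming_compl_tail ?size_rev ?size_compl_tail //.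
by rewrite seq_hamming_rev ?size_compl_tail ?ez ?eb // seq_hamming_compl_tail.
Qed.

Lemma seq_hamming_trap_full : seq_hamming trap_block full_block = 2 * r.
Proof.
have -> : full_block = nseq (r + (k - 2 * r + r)) true by congr nseq; lia.
by rewrite !nseqD !seq_hamming_cat ?size_nseq // !seq_hamming_nseq; lia.
Qed.

Definition jump_size (v : nat) := if v < k then 1 else if v == k then r else 2 * r.

Lemma gk_improve z : size z = k -> z != full_block ->
  exists b, [/\ size b = k, gk k r z < gk k r b & seq_hamming z b = jump_size (gk k r z)].
Proof.
move=> ez nf; have sf : size full_block = k by rewrite size_nseq.
have [->|nt] := eqVneq z trap_block.
  exists full_block; rewrite gk_full gk_trap; split=> //.
  by rewrite /jump_size ltnNge leqnSn /= eqn_leq ltnn seq_hamming_trap_full.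
have gz : gk k r z = count id (compl_tail z).
  by rewrite gk_cases // (negbTE nt) (negbTE nf).
have [al|] := boolP (all id (compl_tail z)).
  have /all_pred1P : all (pred1 true) (compl_tail z) by apply: sub_all al => -[].
  rewrite size_compl_tail ez => cz.
  have kz : gk k r z = k by rewrite gz cz count_nseq mul1n.
  exists full_block; rewrite gk_full kz; split=> //.
  rewrite /jump_size ltnn eqxx -seq_hamming_compl_tail // compl_tail_full cz.
  have -> : nseq k true = nseq (k - r) true ++ nseq r true.
    by rewrite -nseqD subnK //; lia.
  by rewrite seq_hamming_cat ?size_nseq // !seq_hamming_nseq; lia.
move=> nall; have [u [v e]] : exists u v, compl_tail z = u ++ false :: v.
  by move: nall => /allPn [[] // /splitPr [u v] _]; exists u, v.
have se : size (u ++ true :: v) = k.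
  by have := size_compl_tail z; rewrite ez e !size_cat /=; lia.
exists (compl_tail (u ++ true :: v)); split.
- by rewrite size_compl_tail.
- apply: leq_trans (gk_ge_count _ _); last by rewrite size_compl_tail.
  by rewrite gz compl_tailK // e !count_cat /=; lia.
- rewrite -seq_hamming_compl_tail ?size_compl_tail // compl_tailK // e.
  rewrite seq_hamming_cat // seq_hamming_id /seq_hamming /= -/(seq_hamming _ _).
  rewrite seq_hamming_id /jump_size ifT // gz e count_cat /=.
  have := count_size id u; have := count_size id v; move: se; rewrite size_cat /=; lia.
Qed.

Definition lofork (M : nat) (x : seq bool) :=
  \sum_(i < M) gk k r (block k x i) * \prod_(j < i * k) nth false x j.

Lemma lofork0 x : lofork 0 x = 0. Proof. by rewrite /lofork big_ord0. Qed.

Lemma loforkS M b x : size b = k ->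
  lofork M.+1 (b ++ x) = gk k r b + (b == full_block) * lofork M x.
Proof.
move=> eb; rewrite /lofork big_ord_recl mul0n big_ord0 muln1.
rewrite {1}/block mul0n drop0 take_size_cat // big_distrr /=; congr (_ + _).
apply: eq_bigr => i _; rewrite mulnCA /bump /= add1n; congr (_ * _).
  by rewrite /block mulSn addnC -drop_drop drop_size_cat.
rewrite mulSn big_split_ord /=; congr (_ * _); last first.
  by apply: eq_bigr => j _; rewrite nth_cat eb ltnNge leq_addr addKn.
case: eqP => [->|ne].
  by rewrite big1 // => j _; rewrite nth_cat size_nseq ltn_ord nth_nseq ltn_ord.
apply/eqP; apply: contra_notT ne; rewrite -lt0n => h.
apply: (@eq_from_nth _ false) => [|j]; rewrite ?size_nseq // eb => jk.
move: h; rewrite (bigD1 (Ordinal jk)) //= nth_cat eb jk nth_nseq jk.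
by case: nth.
Qed.

Lemma lofork_full_prefix m M x :
  lofork (m + M) (nseq (m * k) true ++ x) = (k + 2) * m + lofork M x.
Proof.
elim: m => [|m IH]; first by rewrite muln0.
by rewrite addSn mulSn nseqD -catA loforkS ?size_nseq // eqxx gk_full IH; lia.
Qed.

Lemma lofork_le M x : size x = M * k -> lofork M x <= (k + 2) * M.
Proof.
elim: M x => [|M IH] x ex; first by rewrite lofork0.
have eb : size (take k x) = k by rewrite size_takel // ex mulSn; lia.
rewrite -(cat_take_drop k x) loforkS //.
have := IH (drop k x); rewrite size_drop ex mulSn addKn => /(_ erefl) le.
case: eqP => [->|/eqP nf]; first by rewrite gk_full; lia.
by have := gk_not_full _ eb nf; lia.
Qed.

Lemma lofork_bad_prefix m M p : size p = m * k -> p != nseq (m * k) true ->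
  exists2 c, c < (k + 2) * m & forall x, lofork (m + M) (p ++ x) = c.
Proof.
elim: m p => [|m IH] p ep; first by rewrite (size0nil ep).
have eb : size (take k p) = k by rewrite size_takel // ep mulSn; lia.
rewrite -(cat_take_drop k p) mulSn nseqD eqseq_cat ?size_nseq // negb_and.
case: (eqVneq (take k p) full_block) => [tf|nf _]; last first.
  exists (gk k r (take k p)); first by have := gk_not_full _ eb nf; lia.
  by move=> x; rewrite addSn -catA loforkS // (negbTE nf) mul0n addn0.
rewrite tf /= => nd.
have [|c lt hc] := IH _ _ nd; first by rewrite size_drop ep mulSn addKn.
exists (gk k r full_block + c); first by rewrite gk_full; lia.
by move=> x; rewrite addSn -catA loforkS ?size_nseq // eqxx mul1n hc.
Qed.

Lemma first_bad_block M x : size x = M * k -> x != nseq (M * k) true ->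
  exists m b s M', [/\ x = nseq (m * k) true ++ b ++ s, size b = k, b != full_block
                     & M = m + M'.+1].
Proof.
elim: M x => [|M IH] x ex; first by rewrite (size0nil ex).
have eb : size (take k x) = k by rewrite size_takel // ex mulSn; lia.
rewrite -(cat_take_drop k x) mulSn nseqD eqseq_cat ?size_nseq // negb_and.
case: (eqVneq (take k x) full_block) => [tf|nf _]; last first.
  by exists 0, (take k x), (drop k x), M.
rewrite tf /= => nd.
have [|m [b [s [M' [e sb nb eM]]]]] := IH _ _ nd; first by rewrite size_drop ex mulSn addKn.
exists m.+1, b, s, M'; split=> //; last by rewrite eM.
by rewrite e mulSn nseqD catA.
Qed.

Definition mirror_at m x :=
  take (m * k) x ++ mirror (take k (drop (m * k) x)) ++ drop (m * k + k) x.

Lemma mirror_at_cat m p b s : size p = m * k -> size b = k ->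
  mirror_at m (p ++ b ++ s) = p ++ mirror b ++ s.
Proof.
move=> ep eb; rewrite /mirror_at take_size_cat // drop_size_cat // take_size_cat //.
by rewrite addnC -drop_drop drop_size_cat // drop_size_cat.
Qed.

Lemma split_at_block m M x : size x = M * k -> m < M ->
  exists p b s, [/\ x = p ++ b ++ s, size p = m * k, size b = k & size s = (M - m.+1) * k].
Proof.
move=> ex mM; have eM : M * k = m * k + (k + (M - m.+1) * k).
  by rewrite -mulSn -mulnDl; congr (_ * _); lia.
exists (take (m * k) x), (take k (drop (m * k) x)), (drop k (drop (m * k) x)).
split; first by rewrite !cat_take_drop.
- by rewrite size_takel // ex eM leq_addr.
- by rewrite size_takel // size_drop ex eM addKn leq_addr.
- by rewrite !size_drop ex eM !addKn.
Qed.

Lemma size_mirror_at m M x : size x = M * k -> m < M -> size (mirror_at m x) = M * k.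
Proof.
move=> ex mM; have [p [b [s [e sp sb ss]]]] := split_at_block _ _ _ ex mM.
by rewrite -ex e mirror_at_cat // size_cat (size_cat (mirror b)) size_mirror !size_cat.
Qed.

Lemma mirror_atK m M x : size x = M * k -> m < M -> mirror_at m (mirror_at m x) = x.
Proof.
move=> ex mM; have [p [b [s [-> sp sb ss]]]] := split_at_block _ _ _ ex mM.
by rewrite !mirror_at_cat ?size_mirror // mirrorK.
Qed.

Lemma seq_hamming_mirror_at m M x y : size x = M * k -> size y = M * k -> m < M ->
  seq_hamming (mirror_at m x) (mirror_at m y) = seq_hamming x y.
Proof.
move=> ex ey mM; have [p [b [s [-> sp sb ss]]]] := split_at_block _ _ _ ex mM.
have [p' [b' [s' [-> sp' sb' ss']]]] := split_at_block _ _ _ ey mM.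
rewrite !mirror_at_cat // (seq_hamming_cat p) ?sp //.
rewrite (seq_hamming_cat (mirror b)) ?size_mirror ?sb // seq_hamming_mirror //.
by rewrite -!seq_hamming_cat ?sb ?sp.
Qed.

Definition trap_value m := (k + 2) * m + k.+1.

Variant level_spec m x : nat -> nat -> Prop :=
| LevelBelow v of v < trap_value m : level_spec m x v v
| LevelAt s v of x = nseq (m * k) true ++ trap_block ++ s & trap_value m < v :
    level_spec m x (trap_value m) v
| LevelAbove s v of x = nseq (m * k) true ++ full_block ++ s & trap_value m < v :
    level_spec m x v (trap_value m).

Lemma levelP m M x : size x = M * k -> m < M ->
  level_spec m x (lofork M x) (lofork M (mirror_at m x)).
Proof.
move=> ex mM; have [p [b [s [-> sp sb ss]]]] := split_at_block _ _ _ ex mM.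
rewrite mirror_at_cat //; have eM : M = m + (M - m.+1).+1 by lia.
rewrite eM; set M' := M - _.
have [->|np] := eqVneq p (nseq (m * k) true); last first.
  have [c lt hc] := lofork_bad_prefix _ M'.+1 _ sp np.
  by rewrite !hc; apply: LevelBelow; rewrite /trap_value; lia.
rewrite !lofork_full_prefix !loforkS ?size_mirror //.
have [->|nt] := eqVneq b trap_block.
  rewrite mirror_trap eqxx (negbTE trap_neq_full) gk_trap gk_full mul0n addn0.
  by apply: (LevelAt _ _ s) => //; rewrite /trap_value; lia.
have [->|nf] := eqVneq b full_block.
  rewrite mirror_full (negbTE trap_neq_full) gk_trap gk_full mul0n addn0.
  by apply: (LevelAbove _ _ s) => //; rewrite /trap_value; lia.
have /negbTE-> : mirror b != full_block.
  by apply: contra nt => /eqP e; rewrite -(mirrorK _ sb) e mirror_full.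
rewrite gk_mirror // mul0n addn0; apply: LevelBelow.
by have := gk_generic _ sb nt nf; rewrite /trap_value; lia.
Qed.

Lemma lofork_improve M x : size x = M * k -> x != nseq (M * k) true ->
  exists y, [/\ size y = M * k, lofork M x < lofork M y &
                seq_hamming x y = jump_size (lofork M x %% (k + 2))].
Proof.
move=> ex nx; have [m [b [s [M' [e sb nb eM]]]]] := first_bad_block _ _ ex nx.
have [b' [sb' lt hb]] := gk_improve _ sb nb.
exists (nseq (m * k) true ++ b' ++ s); split.
- by rewrite -ex e !size_cat sb sb'.
- by rewrite e eM !lofork_full_prefix !loforkS // (negbTE nb); lia.
rewrite e eM !lofork_full_prefix !loforkS // (negbTE nb) mul0n addn0.
rewrite !seq_hamming_cat ?sb ?sb' // !seq_hamming_id addn0 add0n hb.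
rewrite mulnC modnMDl modn_small //; have := gk_not_full _ sb nb; lia.
Qed.

Lemma lofork_ones M : lofork M (nseq (M * k) true) = (k + 2) * M.
Proof. by have := lofork_full_prefix M 0 [::]; rewrite lofork0 cats0 !addn0. Qed.

End Block.

Local Open Scope ring_scope.

(** * The killed chain of the (1+1) EA *)

Section Mutation.
Variables (R : realType) (n : nat).
Hypothesis n_gt0 : (0 < n)%N.
Implicit Types x y : n.-tuple bool.

Lemma hamming_tnth x y : hamming x y = (\sum_(j < n) (tnth x j != tnth y j))%N.
Proof. by apply: eq_bigr => j _; rewrite !(tnth_nth false). Qed.

Lemma mutprob_prod x y :
  mutprob R x y =
  \prod_(j < n) (if tnth x j != tnth y j then n%:R^-1 else 1 - n%:R^-1).
Proof.
set P := fun j : 'I_n => tnth x j != tnth y j.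
have ->: \big[*%R/1]_(j < n) (if P j then n%:R^-1 else 1 - n%:R^-1) =
  \prod_(j < n | P j) (n%:R^-1 : R) * \prod_(j < n | ~~ P j) (1 - n%:R^-1).
  by rewrite (bigID P) /=; congr (_ * _); apply: eq_bigr => j; [move=> -> | move/negbTE ->].
have hE : hamming x y = #|P| by rewrite hamming_tnth -sum1_card [RHS]big_mkcond.
rewrite /mutprob hE !prodr_const; congr (_ * _ ^+ _).
by rewrite -[X in (X - _)%N](card_ord n) -(cardC P) addKn; apply: eq_card => j; rewrite !inE.
Qed.

Let p_ge0 : 0 <= (n%:R^-1 : R). Proof. by rewrite invr_ge0. Qed.
Let q_ge0 : 0 <= 1 - (n%:R^-1 : R).
Proof. by rewrite subr_ge0 invf_le1 ?ltr0n // ler1n. Qed.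

Lemma mutprob_ge0 x y : 0 <= mutprob R x y.
Proof. by rewrite /mutprob mulr_ge0 // exprn_ge0. Qed.

Lemma sum_mutprob_flip x (J : {set 'I_n}) :
  \sum_(y : n.-tuple bool | [forall j in J, tnth y j != tnth x j]) mutprob R x y
  = n%:R^-1 ^+ #|J|.
Proof.
pose F (j : 'I_n) (b : bool) : R :=
  if (j \in J) && (b == tnth x j) then 0
  else if tnth x j != b then n%:R^-1 else 1 - n%:R^-1.
transitivity (\sum_(y : n.-tuple bool) \prod_(j < n) F j (tnth y j)).
  rewrite big_mkcond; apply: eq_bigr => y _; case: ifP => [/forall_inP h|/negbT].
    rewrite mutprob_prod; apply: eq_bigr => j _; rewrite /F.
    by case: (boolP (j \in J)) => [/h/negbTE ->|_].
  rewrite negb_forall_in => /exists_inP [j jJ]; rewrite negbK => /eqP e.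
  by rewrite (bigD1 j) //= /F jJ e eqxx mul0r.
transitivity (\sum_(g : {ffun 'I_n -> bool}) \prod_(j < n) F j (g j)).
  rewrite (reindex (fun g : {ffun 'I_n -> bool} => [tuple g j | j < n])) /=.
    by apply: eq_bigr => g _; apply: eq_bigr => j _; rewrite tnth_mktuple.
  exists (fun y : n.-tuple bool => [ffun j => tnth y j]) => [g _|y _].
    by apply/ffunP => j; rewrite ffunE tnth_mktuple.
  by apply: eq_from_tnth => j; rewrite tnth_mktuple ffunE.
rewrite -(bigA_distr_bigA F) /= -prodr_const [RHS]big_mkcond /=.
apply: eq_bigr => j _; rewrite big_bool /F /=.
by case: (tnth x j); case: (j \in J) => /=; rewrite ?addr0 ?add0r // ?subrK // addrC subrK.
Qed.

Lemma sum_mutprob x : \sum_(y : n.-tuple bool) mutprob R x y = 1.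
Proof.
have := sum_mutprob_flip x finset.set0; rewrite cards0 expr0 => <-.
by apply: eq_bigl => y; apply/esym/forall_inP => j; rewrite inE.
Qed.

End Mutation.

Section KilledChain.
Variables (R : realType) (n : nat) (f : n.-tuple bool -> nat).
Variable opt : n.-tuple bool.
Hypothesis n_gt0 : (0 < n)%N.
Implicit Types x y z : n.-tuple bool.

Local Notation K := (ea_kernel R f).
Local Notation mu := (killed R f opt).
Local Notation tail := (tail_prob R f opt).

Lemma ea_kernel_ge0 x z : 0 <= K x z.
Proof.
rewrite /ea_kernel addr_ge0 //; case: ifP => // _; first exact: mutprob_ge0.
by apply: sumr_ge0 => y _; apply: mutprob_ge0.
Qed.

Lemma sum_ea_kernel x : \sum_z K x z = 1.
Proof.
rewrite /ea_kernel big_split /= -!big_mkcond /= big_pred1_eq -(sum_mutprob R n x).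
rewrite [RHS](bigID (fun z => f x <= f z)%N) /=; congr (_ + _).
by apply: eq_bigl => y; rewrite -ltnNge.
Qed.

Lemma ea_kernel_worse x z : (f z < f x)%N -> K x z = 0.
Proof.
move=> lt; rewrite /ea_kernel leqNgt lt /= add0r; case: eqP => // e.
by rewrite e ltnn in lt.
Qed.

Lemma ea_kernel_better x z : (f x < f z)%N -> K x z = mutprob R x z.
Proof.
move=> lt; rewrite /ea_kernel ltnW //; case: eqP => [e|_]; last by rewrite addr0.
by rewrite e ltnn in lt.
Qed.

Lemma killed_ge0 t x : 0 <= mu t x.
Proof.
elim: t x => [|t IH] x /=; case: ifP => // _.
by apply: sumr_ge0 => y _; rewrite mulr_ge0 // ea_kernel_ge0.
Qed.

Lemma killed_opt t : mu t opt = 0.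
Proof. by case: t => [|t] /=; rewrite eqxx. Qed.

Lemma killedS t z : z != opt -> mu t.+1 z = \sum_x mu t x * K x z.
Proof. by move=> /negbTE /= ->. Qed.

Lemma tail_ge0 t : 0 <= tail t.
Proof. by apply: sumr_ge0 => x _; apply: killed_ge0. Qed.

Lemma sum_uniform : \sum_(x : n.-tuple bool) ((2 ^ n)%:R^-1 : R) = 1.
Proof.
by rewrite sumr_const card_tuple card_bool -[_ *+ _]mulr_natr mulVf // pnatr_eq0 expn_eq0.
Qed.

Lemma tail_sum_le_potential (h : n.-tuple bool -> R) (C : R) :
  (forall x, 0 <= h x) -> (forall x, h x <= C) ->
  (forall x, x != opt -> \sum_z K x z * h z + 1 <= h x) ->
  forall N, \sum_(0 <= t < N) tail t <= C.
Proof.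
move=> h0 hC hd N.
have step t : tail t + \sum_x mu t.+1 x * h x <= \sum_x mu t x * h x.
  have: \sum_z mu t.+1 z * h z <= \sum_x mu t x * \sum_z K x z * h z.
    under [leRHS]eq_bigr do rewrite mulr_sumr.
    rewrite exchange_big /=; apply: ler_sum => z _.
    under [leRHS]eq_bigr do rewrite mulrA.
    rewrite -[leRHS]mulr_suml ler_wpM2r //; case: ifP => // _.
    by apply: sumr_ge0 => x _; rewrite mulr_ge0 ?killed_ge0 ?ea_kernel_ge0.
  move=> le; rewrite -(lerD2l (tail t)) in le; apply: le_trans le _.
  rewrite /tail_prob -big_split /=; apply: ler_sum => x _.
  case: (eqVneq x opt) => [->|xo]; first by rewrite killed_opt !mul0r addr0.
  by rewrite -{1}[mu t x]mulr1 -mulrDr ler_wpM2l ?killed_ge0 // addrC hd.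
have {step} tel : \sum_(0 <= t < N) tail t + \sum_x mu N x * h x <= \sum_x mu 0 x * h x.
  elim: N => [|N IH]; first by rewrite big_geq // add0r.
  by rewrite big_nat_recr //= -addrA; apply: le_trans IH; rewrite lerD2l step.
have: \sum_x mu 0 x * h x <= C.
  rewrite -[leRHS]mul1r -sum_uniform mulr_suml; apply: ler_sum => x _.
  apply: ler_pM => //; first exact: killed_ge0.
  by rewrite /=; case: ifP => // _; rewrite invr_ge0.
have : 0 <= \sum_x mu N x * h x by apply: sumr_ge0 => x _; rewrite mulr_ge0 ?killed_ge0.
by lra.
Qed.

Lemma tail_sum_fitness_levels (w : nat -> R) (U : nat) :
  (forall u, 0 <= w u) -> (forall x, f x <= U)%N ->
  (forall x, x != opt -> exists2 y, (f x < f y)%N & 1 <= w (f x) * mutprob R x y) ->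
  forall N, \sum_(0 <= t < N) tail t <= \sum_(0 <= u < U) w u.
Proof.
move=> w0 fU imp.
pose h x := \sum_(f x <= u < U) w u.
have hmono x z : (f x <= f z)%N -> h x = \sum_(f x <= u < f z) w u + h z.
  by move=> le; rewrite /h (big_cat_nat le) //=.
have s0 a b : 0 <= \sum_(a <= u < b) w u by apply: sumr_ge0.
apply: (@tail_sum_le_potential h) => [x|x|x xo].
- exact: s0.
- by rewrite /h (big_cat_nat (leq0n (f x)) (fU x)) /= lerDr.
have [y fxy wy] := imp x xo.
suff: 1 <= \sum_z K x z * (h x - h z).
  under eq_bigr do rewrite mulrBr.
  by rewrite sumrB -mulr_suml sum_ea_kernel mul1r; lra.
have dge0 z : 0 <= K x z * (h x - h z).
  case: (leqP (f x) (f z)) => [le|lt]; last by rewrite ea_kernel_worse // mul0r.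
  by rewrite mulr_ge0 ?ea_kernel_ge0 // (hmono x z) // addrK.
rewrite (bigD1 y) //=; apply: (@le_trans _ _ (K x y * (h x - h y))); last first.
  by rewrite lerDl; apply: sumr_ge0.
apply: le_trans wy _; rewrite mulrC ea_kernel_better // ler_wpM2l ?mutprob_ge0 //.
by rewrite (hmono x y (ltnW fxy)) addrK big_ltn // lerDl.
Qed.

Section Symmetry.
Variables (theta : nat) (s : n.-tuple bool -> n.-tuple bool) (q : R).
Hypothesis sK : involutive s.
Hypothesis s_ham : forall x y, hamming (s x) (s y) = hamming x y.
Hypothesis s_below : forall x, (f x < theta)%N -> f (s x) = f x.
Hypothesis s_at : forall x, f x = theta -> (theta < f (s x))%N.
Hypothesis s_above : forall x, (theta < f x)%N -> f (s x) = theta.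
Hypothesis opt_above : (theta < f opt)%N.
Hypothesis leave : forall x, f x = theta ->
  \sum_(y : n.-tuple bool | (theta < f y)%N) mutprob R x y <= q.

Lemma sym_lt c x : (c <= theta)%N -> (f (s x) < c)%N = (f x < c)%N.
Proof.
move=> ct; case: (ltngtP (f x) theta) => h.
- by rewrite s_below.
- by rewrite s_above // ltnNge ct ltnNge (leq_trans ct (ltnW h)).
- by have := s_at _ h; lia.
Qed.

Lemma sym_at x : (f (s x) == theta) = (theta < f x)%N.
Proof.
case: (ltngtP (f x) theta) => h.
- by rewrite s_below //; lia.
- by rewrite s_above // eqxx.
- by have := s_at _ h; lia.
Qed.

Lemma sym_mutprob x y : mutprob R (s x) (s y) = mutprob R x y.
Proof. by rewrite /mutprob s_ham. Qed.

Lemma sym_kernel x z : (f x < theta)%N -> K (s x) (s z) = K x z.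
Proof.
move=> lt; have -> : K (s x) (s z) = (if (f x <= f z)%N then mutprob R x z else 0)
    + (if z == x then \sum_(y | (f y < f x)%N) mutprob R (s x) y else 0).
  by rewrite /ea_kernel s_below // leqNgt sym_lt ?(ltnW lt) // -leqNgt sym_mutprob
             (inj_eq (inv_inj sK)).
rewrite /ea_kernel; congr (_ + _); case: ifP => // _.
rewrite (reindex_inj (inv_inj sK)) /=.
by apply: eq_big => y; rewrite ?sym_lt ?(ltnW lt) // sym_mutprob.
Qed.

Lemma sym_killed t z : (f z < theta)%N -> mu t (s z) = mu t z.
Proof.
have nopt x : (f x < theta)%N -> x != opt.
  by move=> h; apply/eqP => e; move: h opt_above; rewrite e; lia.
elim: t z => [|t IH] z fz.
  by rewrite /= !ifN // nopt // s_below.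
rewrite !killedS ?nopt // ?s_below //.
rewrite (reindex_inj (inv_inj sK)) /=; apply: eq_bigr => x _.
case: (ltnP (f x) theta) => fx; first by rewrite sym_kernel // IH.
rewrite !ea_kernel_worse ?mulr0 //; first exact: leq_trans fz fx.
by rewrite s_below //; apply: leq_trans fz _; rewrite leqNgt sym_lt // -leqNgt.
Qed.

Let b t := \sum_(x | (f x < theta)%N) mu t x.
Let a t := \sum_(x | f x == theta) mu t x.
Let phi t := \sum_(x | (f x < theta)%N) \sum_(z | f z == theta) mu t x * K x z.

Lemma sym_flow t :
  phi t = \sum_(x | (f x < theta)%N) \sum_(z | (theta < f z)%N) mu t x * K x z.
Proof.
rewrite /phi (reindex_inj (inv_inj sK)) /=.
apply: eq_big => [x|x]; rewrite sym_lt // => fx.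
rewrite (reindex_inj (inv_inj sK)) /=.
by apply: eq_big => [z|z _]; rewrite ?sym_at // sym_killed // sym_kernel.
Qed.

Lemma sum_trichotomy (g : n.-tuple bool -> R) :
  \sum_x g x = \sum_(x | (f x < theta)%N) g x + \sum_(x | f x == theta) g x
               + \sum_(x | (theta < f x)%N) g x.
Proof.
rewrite (bigID (fun x => f x < theta)%N) /= -addrA; congr (_ + _).
rewrite (bigID (fun x => f x == theta)) /=; congr (_ + _).
  by apply: eq_bigl => x; case: ltngtP.
by apply: eq_bigl => x; case: ltngtP.
Qed.

Lemma mass_below_step t : b t.+1 = b t - 2 * phi t.
Proof.
have bE : b t.+1 = \sum_(x | (f x < theta)%N) \sum_(z | (f z < theta)%N) mu t x * K x z.
  rewrite [RHS]exchange_big /=; apply: eq_bigr => z fz.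
  rewrite killedS; last by apply/eqP => e; move: fz opt_above; rewrite e; lia.
  rewrite (bigID (fun x => f x < theta)%N) /= [X in _ + X]big1 ?addr0 // => x.
  by rewrite -leqNgt => fx; rewrite ea_kernel_worse ?mulr0 // (leq_trans fz).
suff: b t = b t.+1 + phi t + phi t by lra.
rewrite {2}sym_flow bE /phi -!big_split /=; apply: eq_bigr => x fx.
by rewrite -!mulr_sumr -!mulrDr -sum_trichotomy sum_ea_kernel mulr1.
Qed.

Lemma mass_at_step t : phi t + a t * (1 - q) <= a t.+1.
Proof.
have -> : a t.+1 = \sum_x \sum_(z | f z == theta) mu t x * K x z.
  rewrite [RHS]exchange_big /=; apply: eq_bigr => z /eqP fz; apply: killedS.
  by apply/eqP => e; move: fz opt_above; rewrite e; lia.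
rewrite sum_trichotomy -/(phi t) -addrA lerD2l.
apply: (@le_trans _ _ (\sum_(x | f x == theta) \sum_(z | f z == theta) mu t x * K x z)); last first.
  rewrite lerDl; apply: sumr_ge0 => x _; apply: sumr_ge0 => z _.
  by rewrite mulr_ge0 ?killed_ge0 ?ea_kernel_ge0.
rewrite mulr_suml; apply: ler_sum => x /eqP fx; rewrite -mulr_sumr.
rewrite ler_wpM2l ?killed_ge0 // lerBlDr -(sum_ea_kernel x) sum_trichotomy.
rewrite big1 ?add0r => [|z fz]; last by rewrite ea_kernel_worse ?fx.
rewrite lerD2l; apply: le_trans (leave _ fx).
by apply: ler_sum => z fz; rewrite ea_kernel_better ?fx.
Qed.

Lemma mass_init : b 0%N + 2 * a 0%N = 1.
Proof.
have muE x : (f x <= theta)%N -> mu 0%N x = (2 ^ n)%:R^-1.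
  by move=> fx; rewrite /= ifN //; apply/eqP => e; move: fx opt_above; rewrite e; lia.
rewrite -[RHS]sum_uniform (sum_trichotomy (fun=> _)) /b /a.
have bE : \sum_(x | (f x < theta)%N) mu 0 x = \sum_(x | (f x < theta)%N) (2 ^ n)%:R^-1.
  by apply: eq_bigr => x fx; rewrite muE // ltnW.
have aE : \sum_(x | f x == theta) mu 0 x = \sum_(x | f x == theta) (2 ^ n)%:R^-1.
  by apply: eq_bigr => x /eqP fx; rewrite muE ?fx.
have -> : \sum_(x | (theta < f x)%N) ((2 ^ n)%:R^-1 : R) = \sum_(x | f x == theta) (2 ^ n)%:R^-1.
  by rewrite [RHS](reindex_inj (inv_inj sK)) /=; apply: eq_bigl => x; rewrite sym_at.
by rewrite aE bE; lra.
Qed.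

(* By the symmetry, of the mass leaving {f < theta} exactly one half enters
   {f = theta}; there it stays for 1/q steps on average. *)
Lemma occupation_at_level N :
  2^-1 - tail N <= q * \sum_(0 <= t < N) \sum_(x | f x == theta) mu t x.
Proof.
have tel : (b 0%N - b N) / 2 + a 0%N - a N <= q * \sum_(0 <= t < N) a t.
  elim: N => [|N IH]; first by rewrite big_geq // subrr mul0r add0r subrr mulr0.
  rewrite big_nat_recr //= mulrDr.
  by have := mass_below_step N; have := mass_at_step N; lra.
apply: le_trans tel; have := mass_init.
have : b N + a N <= tail N.
  rewrite /tail_prob sum_trichotomy lerDl.
  by apply: sumr_ge0 => x _; apply: killed_ge0.
have : 0 <= a N by apply: sumr_ge0 => x _; apply: killed_ge0.
have : 0 <= b N by apply: sumr_ge0 => x _; apply: killed_ge0.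
by lra.
Qed.

End Symmetry.

Lemma sum_levels_le_tail (M : nat) (theta : nat -> nat) t :
  injective theta ->
  \sum_(0 <= m < M) \sum_(x | f x == theta m) mu t x <= tail t.
Proof.
move=> inj.
rewrite (eq_bigr (fun m => \sum_x if f x == theta m then mu t x else 0)); last first.
  by move=> m _; rewrite big_mkcond.
rewrite exchange_big /=; apply: ler_sum => x _.
have x0 := killed_ge0 t x.
elim: M => [|M IH]; first by rewrite big_geq.
rewrite big_nat_recr //=; case: eqP => [e|_]; last by rewrite addr0.
rewrite big_nat_cond big1 ?add0r // => m /andP [/andP [_ mM] _].
by case: eqP => // e'; have := inj _ _ (etrans (esym e') e); lia.
Qed.

Lemma small_tail (C e : R) : 0 < e ->
  (forall N, \sum_(0 <= t < N) tail t <= C) -> exists N, tail N <= e.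
Proof.
move=> e0 hC; apply: contrapT => /forallNP h.
have C0 : 0 <= C by have := hC 0%N; rewrite big_geq.
pose N := Num.truncn (C / e).
have : C / e < N.+1%:R by rewrite truncnS_gt.
rewrite ltr_pdivrMr // => lt.
have : N.+1%:R * e <= \sum_(0 <= t < N.+1) tail t.
  rewrite mulr_natl -[X in _ *+ X]subn0 -sumr_const_nat; apply: ler_sum => t _.
  by rewrite leNgt; apply/negP => /ltW; apply: h.
by have := hC N.+1; lra.
Qed.

Lemma expected_opt_time_le (C : R) :
  (forall N, \sum_(0 <= t < N) tail t <= C) ->
  (expected_opt_time R f opt <= C%:E)%E.
Proof.
move=> hC; apply: lime_le.
  by apply: is_cvg_nneseries => t _ _; rewrite lee_fin tail_ge0.
by apply: nearW => N; rewrite sumEFin lee_fin.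
Qed.

Lemma expected_opt_time_ge N :
  ((\sum_(0 <= t < N) tail t)%:E <= expected_opt_time R f opt)%E.
Proof.
by rewrite -sumEFin; apply: nneseries_lim_ge => t _ _; rewrite lee_fin tail_ge0.
Qed.

End KilledChain.

(** * LeadingOnes with k-block Fork *)

Lemma bernoulli_sub (R : realFieldType) (p : R) m : 0 <= p <= 1 ->
  1 - m%:R * p <= (1 - p) ^+ m.
Proof.
move=> /andP [p0 p1]; elim: m => [|m IH]; first by rewrite mul0r subr0 expr0.
rewrite exprS; have q0 : 0 <= 1 - p by lra.
apply: le_trans (ler_wpM2l q0 IH); rewrite -natr1.
have : 0 <= m%:R * p * p by rewrite !mulr_ge0.
by lra.
Qed.

Lemma no_flip_ge (R : realFieldType) n : (2 <= n)%N ->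
  8^-1 <= (1 - n%:R^-1) ^+ n :> R.
Proof.
move=> n2; have n0 : (0 : R) < n%:R by rewrite ltr0n; lia.
have hp : (n%:R^-1 : R) <= 2^-1 by rewrite lef_pV2 ?posrE ?ler_nat.
have p0 : 0 < (n%:R^-1 : R) by rewrite invr_gt0.
set q := 1 - _; have q2 : 2^-1 <= q by rewrite /q; lra.
have half : 2^-1 <= q ^+ n./2.
  apply: le_trans (bernoulli_sub _ _ _ _); last by lra.
  have : n./2%:R * n%:R^-1 <= 2^-1 :> R.
    rewrite ler_pdivrMr // ler_pdivlMl // -natrM ler_nat.
    by have := odd_double_half n; lia.
  by lra.
have qo : 2^-1 <= q ^+ odd n by case: (odd n) => //=; rewrite expr0; lra.
rewrite -[X in q ^+ X](odd_double_half n) -addnn !exprD.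
have -> : 8^-1 = 2^-1 * (2^-1 * 2^-1) :> R by lra.
by rewrite !ler_pM ?mulr_ge0 ?invr_ge0.
Qed.

Lemma mutprob_ge (R : realType) n (x y : n.-tuple bool) : (2 <= n)%N ->
  8^-1 * n%:R^-1 ^+ hamming x y <= mutprob R x y.
Proof.
move=> n2; rewrite /mutprob mulrC ler_wpM2l ?exprn_ge0 ?invr_ge0 //.
apply: le_trans (no_flip_ge R _ n2) _.
have p1 : (n%:R^-1 : R) <= 1 by rewrite invf_le1 ?ler1n ?ltr0n; lia.
have p0 : 0 <= (n%:R^-1 : R) by rewrite invr_ge0.
by apply: ler_wiXn2l; rewrite ?leq_subr //; lra.
Qed.

Section LeadingOnesFork.
Variables (R : realType) (k r M : nat).
Hypothesis r_gt1 : (1 < r)%N.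
Hypothesis rk : (2 * r <= k)%N.
Hypothesis M_gt0 : (0 < M)%N.

Let r_gt0 : (0 < r)%N := ltnW r_gt1.
Local Notation n := (M * k)%N.
Local Notation f := (@LOFork n k r).
Implicit Types x y : n.-tuple bool.

Let n_ge2 : (2 <= n)%N.
Proof. by have := leq_mul M_gt0 rk; lia. Qed.

Let n_gt0 : (0 < n)%N := ltnW n_ge2.

Let nR_gt0 : 0 < (n%:R : R). Proof. by rewrite ltr0n. Qed.

Lemma LOFork_seq x : f x = lofork k r M x.
Proof. by rewrite /LOFork mulnK //; lia. Qed.

Lemma LOFork_ones : f (ones n) = ((k + 2) * M)%N.
Proof. by rewrite LOFork_seq lofork_ones. Qed.

Lemma LOFork_le x : (f x <= (k + 2) * M)%N.
Proof. by rewrite LOFork_seq lofork_le ?size_tuple. Qed.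

Lemma LOFork_improve x : x != ones n ->
  exists2 y, (f x < f y)%N & hamming x y = jump_size k r (f x %% (k + 2)).
Proof.
move=> nx; have [||y [sy lt hy]] := lofork_improve k r r_gt0 rk M x.
- by rewrite size_tuple.
- by apply: contra nx => /eqP e; apply/eqP/val_inj.
have /eqP sy' := sy; exists (Tuple sy'); rewrite ?hamming_seq !LOFork_seq //.
Qed.

Lemma sum_jumps_le :
  (\sum_(0 <= u < (k + 2) * M) n ^ jump_size k r (u %% (k + 2)) <= M * (3 * n ^ (2 * r)))%N.
Proof.
have kn : (k <= n)%N by rewrite leq_pmull.
have block_sum : (\sum_(0 <= v < k + 2) n ^ jump_size k r v <= 3 * n ^ (2 * r))%N.
  rewrite addn2 !big_nat_recr //= {2 3}/jump_size ltnn eqxx ltnNge leqnSn /=.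
  rewrite (gtn_eqF (ltnSn k)).
  rewrite big_nat_cond (eq_bigr (fun=> n)); last first.
    by move=> v /andP [/andP [_ vk] _]; rewrite /jump_size vk.
  rewrite -big_nat_cond sum_nat_const_nat subn0.
  have h1 : (n ^ r <= n ^ (2 * r))%N by rewrite leq_pexp2l //; lia.
  have h2 : (n ^ 2 <= n ^ (2 * r))%N by rewrite leq_pexp2l //; lia.
  have h3 : (k * n <= n ^ 2)%N by rewrite -mulnn leq_mul2r kn orbT.
  by lia.
elim: {1 3}M => [|m IH]; first by rewrite muln0 big_geq.
rewrite mulnSr (big_cat_nat (leq0n _) (leq_addr _ _)) /= mulSnr leq_add //.
rewrite -{1}[((k + 2) * m)%N]add0n big_addn addKn.
apply: leq_trans block_sum; rewrite big_nat_cond [leqRHS]big_nat_cond.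
apply: leq_sum => v /andP [/andP [_ vk] _].
by rewrite [((k + 2) * m)%N]mulnC [(v + _)%N]addnC modnMDl modn_small.
Qed.

Lemma tail_sum_le N :
  \sum_(0 <= t < N) tail_prob R f (ones n) t <= 24 * n%:R ^+ (2 * r) * M%:R.
Proof.
pose w u : R := 8 * (n ^ jump_size k r (u %% (k + 2)))%:R.
apply: (@le_trans _ _ (\sum_(0 <= u < (k + 2) * M) w u)).
  apply: tail_sum_fitness_levels => //.
  - by move=> u; rewrite mulr_ge0.
  - exact: LOFork_le.
  - move=> x xo; have [y lt hy] := LOFork_improve _ xo; exists y => //.
    apply: le_trans (ler_wpM2l _ (mutprob_ge R _ x y n_ge2)); last by rewrite mulr_ge0.
    rewrite hy /w natrX exprVn mulrACA divff ?mul1r ?divff //.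
    by rewrite expf_neq0 // gt_eqF.
rewrite /w -mulr_sumr -natr_sum; move: sum_jumps_le; rewrite -(ler_nat R) !natrM natrX.
by rewrite natrM; lra.
Qed.

Lemma val_mirror_at m x : (m < M)%N ->
  val (insubd x (mirror_at k r m x) : n.-tuple bool) = mirror_at k r m x.
Proof. by move=> mM; rewrite val_insubd (size_mirror_at _ _ _ _ _ M) ?eqxx ?size_tuple. Qed.

Lemma leave_trap m x : (m < M)%N -> f x = trap_value k m ->
  \sum_(y : n.-tuple bool | (trap_value k m < f y)%N) mutprob R x y <= n%:R^-1 ^+ (2 * r).
Proof.
move=> mM fx; have lev y := levelP k r r_gt0 rk m M y (size_tuple y) mM.
set x' : n.-tuple bool := insubd x (mirror_at k r m x).
have [s xE] : exists s, val x = nseq (m * k) true ++ trap_block k r ++ s.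
  move: fx; rewrite LOFork_seq.
  by case: lev => [v lt e|s v E _ _|s v _ lt e]; [lia|exists s; rewrite -E|lia].
have x'E : val x' = nseq (m * k) true ++ full_block k ++ s.
  by rewrite val_mirror_at // xE mirror_at_cat ?size_nseq ?size_trap_block ?mirror_trap.
pose J := [set j | tnth x j != tnth x' j]%SET.
have -> : (2 * r)%N = #|J|.
  have -> : #|J| = hamming x x'.
    by rewrite hamming_tnth -sum1_card big_mkcond; apply: eq_bigr => j _; rewrite inE; case: eqP.
  rewrite hamming_seq xE x'E seq_hamming_cat // seq_hamming_id.
  by rewrite seq_hamming_cat ?size_trap_block ?size_nseq // seq_hamming_id
             seq_hamming_trap_full // addn0.
rewrite -(sum_mutprob_flip R n x J) big_mkcond [leRHS]big_mkcond /=.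
apply: ler_sum => y _; case: ifP => [fy|_]; last by case: ifP => // _; apply: mutprob_ge0.
have [s' yE] : exists s, val y = nseq (m * k) true ++ full_block k ++ s.
  move: fy; rewrite LOFork_seq.
  by case: lev => [v lt e|s0 v _ lt e|s0 v E _ _]; [lia|lia|exists s0; rewrite -E].
rewrite ifT //; apply/forall_inP => j; rewrite inE !(tnth_nth false) /= yE x'E xE.
move: (trap_block k r) (size_trap_block k r r_gt0 rk) => tb stb; rewrite !catA.
rewrite !(nth_cat _ (_ ++ _)) !size_cat !size_nseq stb.
by case: ifP => [|_]; last rewrite eqxx; rewrite eq_sym // /full_block -nseqD nth_nseq => ->.
Qed.

Lemma occupation_trap m N : (m < M)%N ->
  (2^-1 - tail_prob R f (ones n) N) * n%:R ^+ (2 * r) <=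
  \sum_(0 <= t < N) \sum_(x | f x == trap_value k m) killed R f (ones n) t x.
Proof.
move=> mM; rewrite -ler_pdivlMr ?exprn_gt0 // -exprVn mulrC.
have vm x := val_mirror_at m x mM.
have lev x := levelP k r r_gt0 rk m M x (size_tuple x) mM.
apply: (occupation_at_level _ _ _ _ n_gt0 _ (fun x => insubd x (mirror_at k r m x))).
- move=> x; apply: val_inj; rewrite !vm /=.
  by rewrite (mirror_atK _ _ _ _ _ M) ?size_tuple.
- move=> x y; rewrite !hamming_seq !vm.
  by rewrite (seq_hamming_mirror_at _ _ _ _ _ M) ?size_tuple.
- by move=> x; rewrite !LOFork_seq vm; case: lev => // *; lia.
- by move=> x; rewrite !LOFork_seq vm; case: lev => // *; lia.
- by move=> x; rewrite !LOFork_seq vm; case: lev => // *; lia.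
- by rewrite LOFork_ones /trap_value; nia.
- by move=> x; apply: leave_trap.
Qed.

Lemma tail_sum_ge N : tail_prob R f (ones n) N <= 4^-1 ->
  4^-1 * n%:R ^+ (2 * r) * M%:R <= \sum_(0 <= t < N) tail_prob R f (ones n) t.
Proof.
move=> tN.
have inj : injective (trap_value k) by move=> m m'; rewrite /trap_value; nia.
apply: (@le_trans _ _ (\sum_(0 <= t < N) \sum_(0 <= m < M)
    \sum_(x | f x == trap_value k m) killed R f (ones n) t x)); last first.
  by apply: ler_sum => t _; apply: sum_levels_le_tail.
have -> : 4^-1 * n%:R ^+ (2 * r) * M%:R = \sum_(0 <= m < M) (4^-1 * n%:R ^+ (2 * r)) :> R.
  by rewrite sumr_const_nat subn0 mulr_natr.
rewrite exchange_big /=.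
rewrite big_nat_cond [leRHS]big_nat_cond; apply: ler_sum => m /andP [/andP [_ mM] _].
apply: le_trans (occupation_trap _ N mM); rewrite ler_wpM2r ?exprn_ge0 //.
by lra.
Qed.

End LeadingOnesFork.

Theorem theorem3 (R : realType) (r : nat) (hr : (2 <= r)%N) :
  exists c1 c2 : R, 0 < c1 /\ 0 < c2 /\
  exists n0 : nat, forall n k : nat,
    (n0 <= n)%N -> (2 <= n)%N -> (k %| n)%N -> (2 * r <= k)%N ->
    ((c1 * n%:R ^+ (2 * r + 1) / k%:R)%:E
       <= expected_opt_time R (@LOFork n k r) (ones n))%E /\
    (expected_opt_time R (@LOFork n k r) (ones n)
       <= (c2 * n%:R ^+ (2 * r + 1) / k%:R)%:E)%E.
Proof.
exists 4^-1, 24; split; first by rewrite invr_gt0.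
split; first by [].
exists 0%N => n k _ n_ge2 /dvdnP [M eM] rk; rewrite {n}eM in n_ge2 *.
have M_gt0 : (0 < M)%N by case: M n_ge2.
have scale (c : R) :
    c * (M * k)%:R ^+ (2 * r + 1) / k%:R = c * (M * k)%:R ^+ (2 * r) * M%:R.
  have k0 : (k%:R : R) != 0 by rewrite pnatr_eq0; lia.
  by rewrite exprD expr1 natrM !mulrA mulfK.
have up := tail_sum_le R k r M hr rk M_gt0.
rewrite !scale; split; last exact: expected_opt_time_le (ltnW n_ge2) _ up.
have quarter_gt0 : 0 < 4^-1 :> R by rewrite invr_gt0.
have [N tN] := small_tail R _ _ _ _ _ quarter_gt0 up.
apply: le_trans (expected_opt_time_ge _ _ _ _ (ltnW n_ge2) N).
by rewrite lee_fin tail_sum_ge.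
Qed.
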